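(* Let $z_i,z_j,z_k\in\mathbb{C}\setminus\{0\}$ and $t_i,t_j,t_k\in\mathbb{C}$, and write $R(a,b)=R_{\Gamma\Gamma}(z_a,t_a,z_b,t_b)$. Then for all spins $\sigma,\tau,\beta,\alpha,\rho,\theta\in\{+,-\}$, $$\sum_{\mu,\nu,\gamma}R(j,k)_{\mu\gamma}^{\rho\alpha}\,R(i,k)_{\nu\beta}^{\theta\gamma}\,R(i,j)_{\sigma\tau}^{\nu\mu}=\sum_{\delta,\phi,\psi}R(j,k)_{\tau\beta}^{\psi\delta}\,R(i,k)_{\sigma\delta}^{\phi\alpha}\,R(i,j)_{\phi\psi}^{\theta\rho},$$ all sums running over $\{+,-\}$.
   Context: Let $V$ be a two-dimensional vector space with basis $v_+,v_-$. For $R\in\operatorname{End}(V\otimes V)$ define $R_{\nu\beta}^{\theta\gamma}$ by $R(v_\nu\otimes v_\beta)=\sum_{\theta,\gamma}R_{\nu\beta}^{\theta\gamma}v_\theta\otimes v_\gamma$; equivalently $R$ is a $4\times4$ matrix (acting on column vectors) in the ordered basis $v_+\otimes v_+,\ v_+\otimes v_-,\ v_-\otimes v_+,\ v_-\otimes v_-$. Define $$R_{\Gamma\Gamma}(z_a,t_a,z_b,t_b)=\begin{pmatrix}z_b+t_bz_a&0&0&0\\0&t_az_b-t_bz_a&z_a(t_a+1)&0\\0&z_b(t_b+1)&z_a-z_b&0\\0&0&0&z_a+t_az_b\end{pmatrix}.$$ *)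

(* Defs.v *)
From HB Require Import structures.
From mathcomp Require Import all_boot all_order all_algebra.
From mathcomp Require Import reals complex.

Set Implicit Arguments.
Unset Strict Implicit.
Unset Printing Implicit Defensive.

Import GRing.Theory.
Local Open Scope ring_scope.

Inductive spin := Plus | Minus.

Definition bool_of_spin (s : spin) : bool := if s is Minus then true else false.
Definition spin_of_bool (b : bool) : spin := if b then Minus else Plus.

Lemma bool_of_spinK : cancel bool_of_spin spin_of_bool.
Proof. by case. Qed.

HB.instance Definition _ := Finite.copy spin (can_type bool_of_spinK).

(* Position of v_a (x) v_b in the ordered basis ++, +-, -+, -- of V (x) V. *)
Definition tidx (a b : spin) : 'I_4 :=
  match a, b with
  | Plus,  Plus  => inord 0
  | Plus,  Minus => inord 1
  | Minus, Plus  => inord 2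
  | Minus, Minus => inord 3
  end.

(* rcoef M nu beta theta gamma is M_{nu beta}^{theta gamma}; since M acts on
   column vectors, the lower (input) spins select the column and the upper
   (output) spins select the row. *)
Definition rcoef (K : nzRingType) (M : 'M[K]_4) (nu beta theta gamma : spin) : K :=
  M (tidx theta gamma) (tidx nu beta).

Definition tvec (K : nzRingType) (a b : spin) : 'cV[K]_4 := delta_mx (tidx a b) 0.

Lemma rcoefE (K : nzRingType) (M : 'M[K]_4) (nu beta : spin) :
  M *m tvec K nu beta =
  \sum_(theta : spin) \sum_(gamma : spin)
     rcoef M nu beta theta gamma *: tvec K theta gamma.
Proof.
have sumE (V : nmodType) (F : spin -> V) : \sum_s F s = F Plus + F Minus.
  rewrite (bigD1 Plus) //= (bigD1 Minus) //= big1 ?addr0 //.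
  by case.
rewrite /tvec -colE !sumE; apply/matrixP => i j.
rewrite !mxE /rcoef ord1 !eqxx !andbT /tidx.
by case: i => [[|[|[|[|//]]]] Hi];
   rewrite -!val_eqE /= !inordK // ?mulr0 ?mulr1 ?addr0 ?add0r;
   congr (M _ _); apply: val_inj; rewrite /= inordK.
Qed.

Definition RGG (K : nzRingType) (za ta zb tb : K) : 'M[K]_4 :=
  \matrix_(r < 4, c < 4)
    nth 0 (nth [::]
      [:: [:: zb + tb * za; 0;                 0;             0            ];
          [:: 0;            ta * zb - tb * za; za * (ta + 1); 0            ];
          [:: 0;            zb * (tb + 1);     za - zb;       0            ];
          [:: 0;            0;                 0;             za + ta * zb ]]
      r) c.

(* Main.v *)
Require Import Defs.
From mathcomp Require Import all_boot all_order all_algebra.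
From mathcomp Require Import reals complex ring.

Import GRing.Theory.
Local Open Scope ring_scope.

(** The two sides are the matrix entries, from input [sigma], [tau], [beta] to output [theta],
    [rho], [alpha], of the triple products R_jk R_ik R_ij and R_ij R_ik R_jk on V (x) V (x) V. Once
    the weights are tabulated in [rcoef_RGG], each of the 64 entries is a polynomial identity in the
    z's and t's, checked by expansion in [RGG_yang_baxter]. *)

(** This is the six-vertex table: the default case is exactly the failure of the ice rule, where
    inputs and outputs contain different numbers of [Minus]. *)
Lemma rcoef_RGG (K : nzRingType) (za ta zb tb : K) (nu beta theta gamma : spin) :
  rcoef (RGG za ta zb tb) nu beta theta gamma =
  match nu, beta, theta, gamma with
  | Plus,  Plus,  Plus,  Plus  => zb + tb * za
  | Plus,  Minus, Plus,  Minus => ta * zb - tb * za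
  | Minus, Plus,  Plus,  Minus => za * (ta + 1)
  | Plus,  Minus, Minus, Plus  => zb * (tb + 1)
  | Minus, Plus,  Minus, Plus  => za - zb
  | Minus, Minus, Minus, Minus => za + ta * zb
  | _, _, _, _ => 0
  end.
Proof.
by rewrite /rcoef mxE; case: nu; case: beta; case: theta; case: gamma;
   rewrite /= !inordK.
Qed.

Lemma sum_spin (V : nmodType) (F : spin -> V) :
  \sum_(s : spin) F s = F Plus + F Minus.
Proof.
by rewrite (bigD1 Plus) //= (bigD1 Minus) //= big1 ?addr0 //; case.
Qed.

Lemma RGG_yang_baxter (K : comNzRingType) (zi zj zk ti tj tk : K)
    (sigma tau beta alpha rho theta : spin) :
  let Rij := rcoef (RGG zi ti zj tj) in
  let Rik := rcoef (RGG zi ti zk tk) in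
  let Rjk := rcoef (RGG zj tj zk tk) in
  \sum_(mu : spin) \sum_(nu : spin) \sum_(gamma : spin)
     Rjk mu gamma rho alpha * Rik nu beta theta gamma * Rij sigma tau nu mu =
  \sum_(delta : spin) \sum_(phi : spin) \sum_(psi : spin)
     Rjk tau beta psi delta * Rik sigma delta phi alpha * Rij phi psi theta rho.
Proof.
rewrite /= !sum_spin !rcoef_RGG.
(* By the ice rule only the 20 cases with equally many [Minus] among inputs and outputs have nonzero
   terms; the other 44 read 0 = 0. *)
by case: sigma; case: tau; case: beta; case: alpha; case: rho; case: theta; ring.
Qed.

Theorem theorem7 (R : realType) (zi zj zk ti tj tk : R[i])
    (hzi : zi != 0) (hzj : zj != 0) (hzk : zk != 0)
    (sigma tau beta alpha rho theta : spin) :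
  let Rij := rcoef (RGG zi ti zj tj) in
  let Rik := rcoef (RGG zi ti zk tk) in
  let Rjk := rcoef (RGG zj tj zk tk) in
  \sum_(mu : spin) \sum_(nu : spin) \sum_(gamma : spin)
     Rjk mu gamma rho alpha * Rik nu beta theta gamma * Rij sigma tau nu mu =
  \sum_(delta : spin) \sum_(phi : spin) \sum_(psi : spin)
     Rjk tau beta psi delta * Rik sigma delta phi alpha * Rij phi psi theta rho.
Proof. exact: RGG_yang_baxter. Qed.
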